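(* Let $((\beta_{x,y}),\{\widetilde{\tau}_x\},\{\widetilde{\omega}_y\},0)$ be an MDI-EW, with the $\widetilde\tau_x$ acting on $H_A$ and the $\widetilde\omega_y$ acting on $H_B$. It is sensitive if there exist POVM operators $\widetilde A$ on $H_A$ and $\widetilde B$ on $H_B$ that satisfy one of the following two conditions: (i) $\mathrm{Tr}\big((\widetilde\tau_x\otimes\widetilde\omega_y)(\widetilde A\otimes\widetilde B)\big)=0$ for each $x,y$; (ii) $\sum_{x,y}\beta_{x,y}\mathrm{Tr}\big((\widetilde\tau_x\otimes\widetilde\omega_y)(\widetilde A\otimes\widetilde B)\big)=0$ and there exist $i,j$ such that $\beta_{i,j}\mathrm{Tr}\big((\widetilde\tau_i\otimes\widetilde\omega_j)(\widetilde A\otimes\widetilde B)\big)\neq 0$.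
   Context: $H_A,H_B$ are finite-dimensional complex Hilbert spaces. A state is a density operator (positive semidefinite, trace one). A POVM operator is a Hermitian operator $E$ with $0\le E\le I$. $T$ denotes transposition in a fixed orthonormal basis. MDI-EW (measurement-device-independent entanglement witness): a tuple $((\beta_{x,y}),\{\widetilde\tau_x\},\{\widetilde\omega_y\},0)$ consisting of a nonzero real matrix $(\beta_{x,y})$ (finite index sets for $x$ and $y$), pure states $\widetilde\tau_x$ on $H_A$ and pure states $\widetilde\omega_y$ on $H_B$ (rank-one projections), such that the operator $\widetilde W=\sum_{x,y}\beta_{x,y}\widetilde\tau_x^T\otimes\widetilde\omega_y^T$ is a weakly optimal entanglement witness, i.e. $\min_{\sigma}\mathrm{Tr}(\widetilde W\sigma)=0$ over all separable states $\sigma$ on $H_A\otimes H_B$ and $\mathrm{Tr}(\widetilde W\rho)<0$ for some entangled state $\rho$. Sensitive: an MDI-EW $((\beta_{x,y}),\{\widetilde\tau_x\},\{\widetilde\omega_y\},0)$ is sensitive if for every $0<\epsilon\le 1$ there exist states $\tau_x$ on $H_A$ and $\omega_y$ on $H_B$ with $\mathrm{Tr}(\tau_x\widetilde\tau_x)\ge 1-\epsilon$ and $\mathrm{Tr}(\omega_y\widetilde\omega_y)\ge 1-\epsilon$ for all $x,y$, and POVM operators $A$ on $H_A$ and $B$ on $H_B$, such that $\sum_{x,y}\beta_{x,y}\mathrm{Tr}(A\tau_x)\mathrm{Tr}(B\omega_y)<0$.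
   Formalization: In condition (i) the POVM operators Ã and B̃ are required to be nonzero; with Ã = 0 or B̃ = 0 condition (i) holds for every MDI-EW, and some MDI-EWs are not sensitive. *)

(* Defs.v *)
(* Operators on C^m are matrices 'M[R[i]]_m with R : realType.
   On R[i], [x <= y] and [x < y] entail that y - x is real; [r%:C] embeds R. *)
From HB Require Import structures.
From mathcomp Require Export all_boot all_order all_algebra.
From mathcomp Require Export reals.
From mathcomp.real_closed Require Export complex mxtens.
Set Implicit Arguments.
Unset Strict Implicit.
Unset Printing Implicit Defensive.
Import Order.TTheory GRing.Theory Num.Theory.
Local Open Scope ring_scope.
Local Open Scope sesquilinear_scope.
Local Open Scope complex_scope.

Definition psdmx (R : realType) (m : nat) (M : 'M[R[i]]_m) : Prop :=
  M \is hermsymmx /\ forall v : 'cV[R[i]]_m, 0 <= (v^t* *m M *m v) 0 0.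

Definition is_state (R : realType) (m : nat) (rho : 'M[R[i]]_m) : Prop :=
  psdmx rho /\ \tr rho = 1.

Definition is_pure_state (R : realType) (m : nat) (P : 'M[R[i]]_m) : Prop :=
  [/\ P \is hermsymmx, P *m P = P & \rank P = 1%N].

Definition is_povm_operator (R : realType) (m : nat) (E : 'M[R[i]]_m) : Prop :=
  psdmx E /\ psdmx (1%:M - E).

(* The Hilbert space C^m (x) C^n is C^(m * n), through the Kronecker product. *)
Definition is_separable_state (R : realType) (m n : nat)
    (sigma : 'M[R[i]]_(m * n)) : Prop :=
  exists (k : nat) (p : 'I_k -> R)
         (rho : 'I_k -> 'M[R[i]]_m) (theta : 'I_k -> 'M[R[i]]_n),
    [/\ forall l, 0 <= p l,
        \sum_l p l = 1,
        forall l, is_state (rho l) /\ is_state (theta l) &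
        sigma = \sum_l (p l)%:C *: tensmx (rho l) (theta l)].

Definition is_entangled_state (R : realType) (m n : nat)
    (rho : 'M[R[i]]_(m * n)) : Prop :=
  is_state rho /\ ~ is_separable_state rho.

(* The first two clauses say that the minimum of Tr(W sigma) over separable
   sigma exists and is 0. *)
Definition weakly_optimal_witness (R : realType) (m n : nat)
    (W : 'M[R[i]]_(m * n)) : Prop :=
  [/\ forall sigma, is_separable_state sigma -> 0 <= \tr (W *m sigma),
      exists2 sigma, is_separable_state sigma & \tr (W *m sigma) = 0 &
      exists2 rho, is_entangled_state rho & \tr (W *m rho) < 0].

Definition witness_operator (R : realType) (m n : nat) (X Y : finType)
    (beta : X -> Y -> R) (tau : X -> 'M[R[i]]_m) (omega : Y -> 'M[R[i]]_n) :
    'M[R[i]]_(m * n) :=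
  \sum_x \sum_y (beta x y)%:C *: tensmx (tau x)^T (omega y)^T.

(* The tuple (beta, tau, omega, 0); the constant bound 0 is left implicit. *)
Definition is_MDIEW (R : realType) (m n : nat) (X Y : finType)
    (beta : X -> Y -> R) (tau : X -> 'M[R[i]]_m) (omega : Y -> 'M[R[i]]_n) :
    Prop :=
  [/\ exists x y, beta x y != 0,
      forall x, is_pure_state (tau x),
      forall y, is_pure_state (omega y) &
      weakly_optimal_witness (witness_operator beta tau omega)].

Definition sensitive (R : realType) (m n : nat) (X Y : finType)
    (beta : X -> Y -> R) (tau0 : X -> 'M[R[i]]_m) (omega0 : Y -> 'M[R[i]]_n) :
    Prop :=
  forall eps : R, 0 < eps -> eps <= 1 ->
  exists (tau : X -> 'M[R[i]]_m) (omega : Y -> 'M[R[i]]_n),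
    [/\ forall x, is_state (tau x) /\ (1 - eps)%:C <= \tr (tau x *m tau0 x),
        forall y, is_state (omega y)
                  /\ (1 - eps)%:C <= \tr (omega y *m omega0 y) &
        exists (A : 'M[R[i]]_m) (B : 'M[R[i]]_n),
          [/\ is_povm_operator A, is_povm_operator B &
              \sum_x \sum_y
                (beta x y)%:C * \tr (A *m tau x) * \tr (B *m omega y) < 0]].

(* Main.v *)
Require Import Defs.
From mathcomp Require Import boolp ring.
Set Implicit Arguments.
Unset Strict Implicit.
Unset Printing Implicit Defensive.
(* Case (i): one party, say A, has Tr(A tau_x) = 0 for all x. The operators
   sum_y beta x y omega_y are not all positive, otherwise the witness would be a
   sum of tensor products of positive operators. Mixing a little of A / Tr A
   into tau_x at an x where positivity fails, and letting B project on a vector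
   that shows the failure, makes the correlation negative.

   Case (ii): with c_x = sum_y beta x y Tr(B omega_y), the operator
   M = sum_x c_x tau_x is positive, because the witness is nonnegative on
   product states, and Tr(A M) = 0. If A is invertible then M = 0, so A may be
   replaced by tau_i. Hence A and likewise B may be taken singular. Mixing states
   from their kernels into selected tau_x and omega_y then shrinks selected rows
   and columns of the matrix beta x y Tr(A tau_x) Tr(B omega_y), which is nonzero
   with zero total; some selection makes the total negative. *)
Import Order.TTheory GRing.Theory Num.Theory.
Local Open Scope ring_scope.
Local Open Scope sesquilinear_scope.
Local Open Scope complex_scope.

(** * Gram matrices and the Hilbert-Schmidt norm *)

Lemma adjmx_mul (C : numClosedFieldType) (m n p : nat) (A : 'M[C]_(m, n))
    (B : 'M[C]_(n, p)) :
  (A *m B)^t* = B^t* *m A^t*.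
Proof. by rewrite trmx_mul map_mxM. Qed.

Lemma adjmx_mul_diag (C : numClosedFieldType) (m n : nat) (S : 'M[C]_(m, n))
    (j : 'I_n) :
  (S^t* *m S) j j = \sum_i `|S i j| ^+ 2.
Proof.
by rewrite mxE; apply: eq_bigr => i _; rewrite !mxE normCKC.
Qed.

Lemma mxtrace_adjmx_mul_ge0 (C : numClosedFieldType) (m n : nat)
    (S : 'M[C]_(m, n)) :
  0 <= \tr (S^t* *m S).
Proof.
apply: sumr_ge0 => j _; rewrite adjmx_mul_diag.
by apply: sumr_ge0 => i _; rewrite exprn_ge0.
Qed.

Lemma mxtrace_adjmx_mul_eq0 (C : numClosedFieldType) (m n : nat)
    (S : 'M[C]_(m, n)) :
  \tr (S^t* *m S) = 0 -> S = 0.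
Proof.
have ge0 i j : 0 <= `|S i j| ^+ 2 by rewrite exprn_ge0.
move/eqP; rewrite psumr_eq0 => [/allP trS0|j _]; last first.
  by rewrite adjmx_mul_diag sumr_ge0.
apply/matrixP => i j; rewrite mxE; apply/eqP.
have := trS0 j; rewrite mem_index_enum adjmx_mul_diag => /(_ isT) /=.
rewrite psumr_eq0 => // /allP /(_ i); rewrite mem_index_enum => /(_ isT) /=.
by rewrite expf_eq0 normr_eq0.
Qed.

(** * Positive semidefinite operators *)

Section Positivity.
Variable R : realType.
Local Notation C := R[i].

Lemma hermsymmxP (m : nat) (M : 'M[C]_m) : reflect (M^t* = M) (M \is hermsymmx).
Proof.
rewrite is_hermitianmxE expr0 scale1r eq_sym; exact: eqP.
Qed.

Lemma psdmx_gram (m n : nat) (S : 'M[C]_(n, m)) : psdmx (S^t* *m S).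
Proof.
split=> [|v]; first by apply/hermsymmxP; rewrite adjmx_mul trmxCK.
rewrite mulmxA -adjmx_mul -mulmxA adjmx_mul_diag.
by apply: sumr_ge0 => i _; rewrite exprn_ge0.
Qed.

(** Spectral theorem: diagonalize [M] and put the square roots of the eigenvalues into [S]. Such
    factors turn traces into sums of squares. *)
Lemma psdmxP (m : nat) (M : 'M[C]_m) :
  psdmx M -> exists S : 'M[C]_m, M = S^t* *m S.
Proof.
move=> [hM M_ge0].
have /hermitian_normalmx/orthomx_spectralP := hM.
set P := spectralmx M; set d := spectral_diag M.
have uP : P \is unitarymx := spectral_unitarymx M.
rewrite invmx_unitary // => Mdef.
(* On the [i]-th column of [P^t*], an eigenvector, the quadratic form returns the eigenvalue. *)
have d_ge0 i : 0 <= d 0 i.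
  have := M_ge0 (P^t* *m delta_mx i 0).
  rewrite Mdef adjmx_mul trmxCK !mulmxA !mulmxtVK //.
  have -> : (delta_mx i 0 : 'cV[C]_m)^t* = delta_mx 0 i.
    by apply/matrixP => a b; rewrite !mxE andbC; case: (_ && _);
      rewrite ?rmorph1 ?rmorph0.
  by rewrite -rowE -colE !mxE eqxx mulr1n.
exists (diag_mx (map_mx sqrtC d) *m P).
rewrite adjmx_mul mulmxA -[X in X *m P]mulmxA [in LHS]Mdef; congr (_ *m _ *m _).
rewrite tr_diag_mx map_diag_mx mulmx_diag; congr diag_mx.
apply/rowP => i; rewrite !mxE.
have /conj_Creal conjE := sqrtC_real (d_ge0 i).
by rewrite [X in X * _]conjE -expr2 sqrtCK.
Qed.

Lemma psdmx_trmx (m : nat) (M : 'M[C]_m) : psdmx M -> psdmx M^T.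
Proof.
move=> /psdmxP[S ->].
have -> : (S^t* *m S)^T = (map_mx Num.conj S)^t* *m map_mx Num.conj S.
  rewrite trmx_mul; congr (_ *m _); apply/matrixP => i j; rewrite !mxE //.
  by rewrite conjCK.
exact: psdmx_gram.
Qed.

Lemma psdmxD (m : nat) (M N : 'M[C]_m) : psdmx M -> psdmx N -> psdmx (M + N).
Proof.
move=> [/hermsymmxP hM pM] [/hermsymmxP hN pN]; split=> [|v].
  by apply/hermsymmxP; rewrite linearD map_mxD hM hN.
by rewrite mulmxDr mulmxDl mxE addr_ge0.
Qed.

Lemma psdmxZ (m : nat) (a : C) (M : 'M[C]_m) :
  0 <= a -> psdmx M -> psdmx (a *: M).
Proof.
move=> a0 [/hermsymmxP hM pM]; split=> [|v].
  by apply/hermsymmxP; rewrite linearZ map_mxZ hM /= conj_Creal ?ger0_real.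
by rewrite -scalemxAr -scalemxAl mxE mulr_ge0.
Qed.

(** By cyclicity, the trace of a product of positive operators is a squared Hilbert-Schmidt norm. *)
Lemma mxtrace_gram_mul (m n p : nat) (S : 'M[C]_(n, m)) (T : 'M[C]_(p, m)) :
  \tr (S^t* *m S *m (T^t* *m T)) = \tr ((S *m T^t*)^t* *m (S *m T^t*)).
Proof.
by rewrite adjmx_mul trmxCK mulmxA mxtrace_mulC !mulmxA.
Qed.

Lemma mxtrace_psd_mul_ge0 (m : nat) (M N : 'M[C]_m) :
  psdmx M -> psdmx N -> 0 <= \tr (M *m N).
Proof.
move=> /psdmxP[S ->] /psdmxP[T ->]; rewrite mxtrace_gram_mul.
exact: mxtrace_adjmx_mul_ge0.
Qed.

(** Zero norm forces [S *m T^t* = 0], and the factor [S] of [M] is invertible along with [M]. *)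
Lemma mxtrace_psd_mul_eq0 (m : nat) (M N : 'M[C]_m) :
  psdmx M -> psdmx N -> M \in unitmx -> \tr (M *m N) = 0 -> N = 0.
Proof.
move=> /psdmxP[S ->] /psdmxP[T ->]; rewrite unitmx_mul => /andP[_ Su].
rewrite mxtrace_gram_mul => /mxtrace_adjmx_mul_eq0 ST0.
by rewrite -[T^t*](mulKmx Su) ST0 mulmx0 mul0mx.
Qed.

Lemma mxtrace_psd_ge0 (m : nat) (M : 'M[C]_m) : psdmx M -> 0 <= \tr M.
Proof. by move=> /psdmxP[S ->]; apply: mxtrace_adjmx_mul_ge0. Qed.

Lemma mxtrace_psd_eq0 (m : nat) (M : 'M[C]_m) : psdmx M -> \tr M = 0 -> M = 0.
Proof. by move=> /psdmxP[S ->] /mxtrace_adjmx_mul_eq0 ->; rewrite mulmx0. Qed.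

Lemma psdmx_tens (m n : nat) (M : 'M[C]_m) (N : 'M[C]_n) :
  psdmx M -> psdmx N -> psdmx (tensmx M N).
Proof.
move=> /psdmxP[S ->] /psdmxP[T ->]; rewrite -tensmx_mul -map_mxT -trmx_tens.
exact: psdmx_gram.
Qed.

(** * States and projections *)

Lemma is_state_normalize (m : nat) (M : 'M[C]_m) :
  psdmx M -> M != 0 -> is_state ((\tr M)^-1 *: M).
Proof.
move=> pM M0; have tr0 : \tr M != 0.
  by apply: contra_neq M0 => /(mxtrace_psd_eq0 pM).
split; first by apply: psdmxZ => //; rewrite invr_ge0 mxtrace_psd_ge0.
by rewrite mxtraceZ mulVf.
Qed.

(** In a full-rank factorization [P = c *m r], idempotence cancels to [r *m c = 1], whose size is
    the rank. *)
Lemma idempotent_mxtrace (F : fieldType) (m : nat) (P : 'M[F]_m) :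
  P *m P = P -> \tr P = (\rank P)%:R.
Proof.
move=> PP; move: (mulmx_base P) (row_base_free P) (col_base_full P).
move: (col_base P) (row_base P) => c r crP r_free c_full.
rewrite -{1}crP mxtrace_mulC; suff -> : r *m c = 1%:M by rewrite mxtrace1.
apply: (row_free_inj r_free); rewrite /= mul1mx.
by apply: (row_full_inj c_full); rewrite !mulmxA crP -mulmxA crP PP.
Qed.

Lemma mxtrace_pure (m : nat) (P : 'M[C]_m) : is_pure_state P -> \tr P = 1.
Proof. by move=> [_ PP rP]; rewrite idempotent_mxtrace // rP. Qed.

Lemma psdmx_projection (m : nat) (P : 'M[C]_m) :
  P \is hermsymmx -> P *m P = P -> psdmx P.
Proof. by move=> /hermsymmxP hP PP; rewrite -PP -{1}hP; apply: psdmx_gram. Qed.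

Lemma povm_projection (m : nat) (P : 'M[C]_m) :
  P \is hermsymmx -> P *m P = P -> is_povm_operator P.
Proof.
move=> hP PP; split; first exact: psdmx_projection.
apply: psdmx_projection.
  by apply/hermsymmxP; rewrite linearB /= map_mxB trmx1 map_mx1;
     move/hermsymmxP: hP => ->.
by rewrite mulmxBl mul1mx mulmxBr mulmx1 PP subrr subr0.
Qed.

Lemma pure_is_state (m : nat) (P : 'M[C]_m) : is_pure_state P -> is_state P.
Proof.
by move=> hP; split;
  [case: hP => *; apply: psdmx_projection | exact: mxtrace_pure].
Qed.

Lemma state_mix (m : nat) (t : R) (rho sigma : 'M[C]_m) :
  0 <= t -> t <= 1 -> is_state rho -> is_state sigma ->
  is_state ((1 - t)%:C *: rho + t%:C *: sigma).
Proof.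
move=> t0 t1 [pr tr] [ps ts]; split.
  by apply: psdmxD; apply: psdmxZ => //; rewrite lecR // subr_ge0.
by rewrite mxtraceD !mxtraceZ tr ts !mulr1 -rmorphD subrK.
Qed.

(** A row [v] with [v *m A = 0] yields the state proportional to [v^t* *m v]. *)
Lemma singular_orthogonal_state (m : nat) (A : 'M[C]_m) :
  A \notin unitmx -> exists2 rho, is_state rho & \tr (A *m rho) = 0.
Proof.
rewrite -row_free_unit -kermx_eq0 => /rowV0Pn[v /sub_kermxP vA v0].
have p := psdmx_gram v.
have nz : v^t* *m v != 0.
  by apply: contra_neq v0 => e; apply: mxtrace_adjmx_mul_eq0; rewrite e mxtrace0.
exists ((\tr (v^t* *m v))^-1 *: (v^t* *m v)); first exact: is_state_normalize.
by rewrite -scalemxAr mxtraceZ [\tr (A *m _)]mxtrace_mulC -mulmxA vA mulmx0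
  mxtrace0 mulr0.
Qed.

Lemma mxtrace_tens (m n : nat) (A : 'M[C]_m) (B : 'M[C]_n) :
  \tr (tensmx A B) = \tr A * \tr B.
Proof. by rewrite /mxtrace mulr_sum; apply: eq_bigr => k _; rewrite mxE. Qed.

(** * Hermitian operators and detection of non-positivity *)

Lemma hermsymmx_sum (m : nat) (I : finType) (F : I -> 'M[C]_m) :
  (forall k, F k \is hermsymmx) -> \sum_k F k \is hermsymmx.
Proof.
move=> hF; apply/hermsymmxP; rewrite !raddf_sum /=.
by apply: eq_bigr => k _; apply/hermsymmxP.
Qed.

Lemma hermsymmxZ (m : nat) (a : C) (M : 'M[C]_m) :
  a \is Num.real -> M \is hermsymmx -> a *: M \is hermsymmx.
Proof.
move=> ra /hermsymmxP hM; apply/hermsymmxP.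
by rewrite linearZ /= map_mxZ hM; congr (_ *: _); apply: conj_Creal.
Qed.

Lemma mxtrace_outer_mul (m : nat) (v : 'cV[C]_m) (M : 'M[C]_m) :
  \tr (v *m v^t* *m M) = (v^t* *m M *m v) 0 0.
Proof. by rewrite -mulmxA mxtrace_mulC trace_mx11. Qed.

Lemma psdmx_outer (m : nat) (v : 'cV[C]_m) : psdmx (v *m v^t*).
Proof. by rewrite -{1}[v]trmxCK; apply: psdmx_gram. Qed.

Lemma psdmx_of_mxtrace_ge0 (m : nat) (M : 'M[C]_m) :
  M \is hermsymmx -> (forall B, psdmx B -> 0 <= \tr (B *m M)) -> psdmx M.
Proof.
move=> hM M_ge0; split=> // v; rewrite -mxtrace_outer_mul.
exact/M_ge0/psdmx_outer.
Qed.

Lemma povm_detects_not_psd (m : nat) (M : 'M[C]_m) :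
  M \is hermsymmx -> ~ psdmx M ->
  exists2 B, is_povm_operator B & \tr (B *m M) < 0.
Proof.
move=> hM npM.
have [v v_lt0] : exists v : 'cV_m, (v^t* *m M *m v) 0 0 < 0.
  apply: contrapT => /forallNP v_ge0; apply: npM; split=> // v.
  have := v_ge0 v; rewrite -mxtrace_outer_mul => /negP.
  (* The order on [C] is partial: not negative gives nonnegative only for a real value, which [M]
     Hermitian ensures. *)
  rewrite -real_leNgt ?real0 //; apply/CrealP.
  rewrite mxtrace_outer_mul.
  have : (v^t* *m M *m v)^t* = v^t* *m M *m v.
    by rewrite !adjmx_mul trmxCK (hermsymmxP _ hM) mulmxA.
  by move: (v^t* *m M *m v) => w /matrixP/(_ 0 0); rewrite !mxE.
pose c := \tr (v^t* *m v).
have c_gt0 : 0 < c.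
  rewrite lt_def mxtrace_adjmx_mul_ge0 andbT.
  apply: contraTneq v_lt0 => /mxtrace_adjmx_mul_eq0 ->.
  by rewrite mulmx0 mxE ltxx.
exists (c^-1 *: (v *m v^t*)); last first.
  by rewrite -scalemxAl mxtraceZ mxtrace_outer_mul pmulr_rlt0 ?invr_gt0.
have cE : v^t* *m v = c%:M by rewrite [LHS]mx11_scalar /c trace_mx11.
apply: povm_projection.
  by apply: hermsymmxZ; [rewrite realV gtr0_real | case: (psdmx_outer v)].
rewrite -scalemxAl -scalemxAr -[v *m _ *m _]mulmxA [v^t* *m _]mulmxA cE.
by rewrite mul_scalar_mx -scalemxAr !scalerA divfK // gt_eqF.
Qed.

Lemma nonunit_pure (m : nat) (P : 'M[C]_m) :
  (1 < m)%N -> is_pure_state P -> P \notin unitmx.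
Proof.
move=> m1 [_ _ rP]; rewrite -row_free_unit /row_free rP.
by rewrite neq_ltn m1.
Qed.

(* If A is invertible then M vanishes, so any operator may replace A. *)
Lemma singular_povm (m : nat) (A M P : 'M[C]_m) :
  (1 < m)%N -> is_povm_operator A -> psdmx M -> \tr (A *m M) = 0 ->
  is_pure_state P -> \tr (A *m P) != 0 ->
  exists A', [/\ is_povm_operator A', A' \notin unitmx,
                 \tr (A' *m M) = 0 & \tr (A' *m P) != 0].
Proof.
move=> m1 pA pM trAM pureP trAP; have [Au|] := boolP (A \in unitmx); last first.
  by exists A.
have M0 : M = 0 by case: pA => pA _; apply: (mxtrace_psd_mul_eq0 pA pM Au).
exists P; have [hP PP _] := pureP; split.
- exact: povm_projection.
- exact: nonunit_pure.
- by rewrite M0 mulmx0 mxtrace0.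
- by rewrite PP mxtrace_pure ?oner_neq0.
Qed.

(** * Mixing noise into selected inputs *)

Definition mix_on (m : nat) (X : finType) (tau : X -> 'M[C]_m) (t : R)
    (S : pred X) (rho : 'M[C]_m) (x : X) : 'M[C]_m :=
  (1 - t * (S x)%:R)%:C *: tau x + (t * (S x)%:R)%:C *: rho.

(** The noise overlaps nonnegatively with [tau x], so the overlap drops from one by at most the
    weight [t], which later is the tolerance in [sensitive]. *)
Lemma mix_onP (m : nat) (X : finType) (tau : X -> 'M[C]_m) (t : R)
    (S : pred X) (rho : 'M[C]_m) :
  (forall x, is_pure_state (tau x)) -> is_state rho -> 0 <= t -> t <= 1 ->
  forall x, is_state (mix_on tau t S rho x)
            /\ (1 - t)%:C <= \tr (mix_on tau t S rho x *m tau x).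
Proof.
move=> htau hrho t0 t1 x; have hx := htau x; have [_ PP _] := hx.
have u0 : 0 <= t * (S x)%:R by rewrite mulr_ge0 // ler0n.
have u1 : t * (S x)%:R <= t by case: (S x); rewrite ?mulr1 ?mulr0.
split; first by apply: state_mix; rewrite ?(le_trans u1) //; apply: pure_is_state.
rewrite /mix_on mulmxDl -!scalemxAl mxtraceD !mxtraceZ PP mxtrace_pure // mulr1.
apply: (@le_trans _ _ (1 - t * (S x)%:R)%:C).
  by rewrite lecR lerD2l lerN2.
rewrite lerDl mulr_ge0 ?lecR //; apply: mxtrace_psd_mul_ge0; first by case: hrho.
by case: (pure_is_state hx).
Qed.

Lemma mxtrace_mix_on (m : nat) (X : finType) (tau : X -> 'M[C]_m) (t : R)
    (S : pred X) (rho A : 'M[C]_m) (x : X) :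
  \tr (A *m mix_on tau t S rho x) =
  (1 - t * (S x)%:R)%:C * \tr (A *m tau x) + (t * (S x)%:R)%:C * \tr (A *m rho).
Proof. by rewrite mulmxDr -!scalemxAr mxtraceD !mxtraceZ. Qed.

End Positivity.

(** * Signs in real families with zero sum *)

Lemma sum_eq0_exists_gt0 (R : realDomainType) (I : finType) (F : I -> R)
    (i : I) :
  \sum_k F k = 0 -> F i != 0 -> exists k, 0 < F k.
Proof.
move=> F0 Fi; apply/existsP; apply: contraNT Fi.
rewrite negb_exists => /forallP le0.
have: \sum_k - F k == 0 by rewrite sumrN F0 oppr0.
rewrite psumr_eq0 => [/allP/(_ i)|k _]; last by rewrite oppr_ge0 leNgt.
by rewrite mem_index_enum oppr_eq0; apply.
Qed.

Lemma sum_eq0_exists_lt0 (R : realDomainType) (I : finType) (F : I -> R)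
    (i : I) :
  \sum_k F k = 0 -> F i != 0 -> exists k, F k < 0.
Proof.
move=> F0 Fi; have [||k] := @sum_eq0_exists_gt0 R I (fun k => - F k) i.
- by rewrite sumrN F0 oppr0.
- by rewrite oppr_eq0.
by rewrite oppr_gt0; exists k.
Qed.

(* Shrinking row i and column j changes the total by
   - t * (row sum) - t * (column sum) + t^2 * M i j: a positive row or column
   suffices, and if all of them vanish, a negative entry does. *)
Lemma shrink_rows_cols_lt0 (R : realDomainType) (X Y : finType)
    (M : X -> Y -> R) (t : R) (i : X) (j : Y) :
  0 < t -> \sum_x \sum_y M x y = 0 -> M i j != 0 ->
  exists (S : pred X) (T : pred Y),
    \sum_x \sum_y (1 - t * (S x)%:R) * (1 - t * (T y)%:R) * M x y < 0.
Proof.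
move=> t0 M0 Mij.
have sum1 (I : finType) (k : I) (F : I -> R) :
    \sum_l (1 - t * (l == k)%:R) * F l = \sum_l F l - t * F k.
  rewrite (bigD1 k) //= [X in _ = X - _](bigD1 k) //= eqxx mulr1 mulrBl mul1r.
  rewrite addrAC; congr (_ + _ - _); apply: eq_bigr => l /negbTE ->.
  by rewrite mulr0 subr0 mul1r.
have [k rk|row0] := pickP (fun x => \sum_y M x y != 0).
  have [k' rk'] := sum_eq0_exists_gt0 M0 rk.
  exists (pred1 k'), pred0.
  under eq_bigr => x _.
    under eq_bigr => y _ do rewrite mulr0 subr0 mulr1.
    rewrite -mulr_sumr; over.
  by rewrite sum1 M0 sub0r oppr_lt0 mulr_gt0.
have [k ck|col0] := pickP (fun y => \sum_x M x y != 0).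
  have M0' : \sum_y \sum_x M x y = 0 by rewrite exchange_big.
  have [k' ck'] := sum_eq0_exists_gt0 M0' ck.
  exists pred0, (pred1 k'); rewrite exchange_big /=.
  under eq_bigr => y _.
    under eq_bigr => x _ do rewrite mulr0 subr0 mul1r.
    rewrite -mulr_sumr; over.
  by rewrite sum1 M0' sub0r oppr_lt0 mulr_gt0.
(* Row [i] now sums to zero and contains the nonzero [M i j], so it also has a negative entry. *)
have /eqP ri : \sum_y M i y == 0 by have /negbFE := row0 i.
have [k Mik] := sum_eq0_exists_lt0 ri Mij.
exists (pred1 i), (pred1 k).
under eq_bigr => x _.
  under eq_bigr => y _ do rewrite -mulrA.
  rewrite -mulr_sumr sum1 (eqP (negbFE (row0 x))) sub0r; over.
rewrite sum1 sumrN -mulr_sumr (eqP (negbFE (col0 k))) mulr0 oppr0 sub0r.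
rewrite mulrN opprK.
by rewrite !pmulr_rlt0.
Qed.

(** * Correlations and the witness operator *)

Definition correlation (R : realType) (m n : nat) (X Y : finType)
    (beta : X -> Y -> R) (tau : X -> 'M[R[i]]_m) (omega : Y -> 'M[R[i]]_n)
    (A : 'M[R[i]]_m) (B : 'M[R[i]]_n) : R[i] :=
  \sum_x \sum_y (beta x y)%:C * \tr (A *m tau x) * \tr (B *m omega y).

Definition conditional_operator (R : realType) (n : nat) (X Y : finType)
    (beta : X -> Y -> R) (omega : Y -> 'M[R[i]]_n) (x : X) : 'M[R[i]]_n :=
  \sum_y (beta x y)%:C *: omega y.

(** The effective observable of the second party once [A] is fixed: its trace against [B] is the
    correlation. *)
Definition marginal_operator (R : realType) (m n : nat) (X Y : finType)
    (beta : X -> Y -> R) (tau : X -> 'M[R[i]]_m) (omega : Y -> 'M[R[i]]_n)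
    (A : 'M[R[i]]_m) : 'M[R[i]]_n :=
  \sum_x \tr (A *m tau x) *: conditional_operator beta omega x.

(** The cone of separable operators, without normalization. *)
Definition psd_tensor_sum (R : realType) (m n : nat) (M : 'M[R[i]]_(m * n)) :
    Prop :=
  exists (I : finType) (P : I -> 'M[R[i]]_m) (Q : I -> 'M[R[i]]_n),
    [/\ forall k, psdmx (P k), forall k, psdmx (Q k) &
        M = \sum_k tensmx (P k) (Q k)].

Section Correlation.
Variables (R : realType) (m n : nat) (X Y : finType) (beta : X -> Y -> R).
Variables (tau : X -> 'M[R[i]]_m) (omega : Y -> 'M[R[i]]_n).
Local Notation C := R[i].
Local Notation corr := (correlation beta tau omega).
Local Notation W := (witness_operator beta tau omega).
Local Notation cond := (conditional_operator beta omega).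
Local Notation marg := (marginal_operator beta tau omega).

Lemma correlation_swap (A : 'M[C]_m) (B : 'M[C]_n) :
  corr A B = correlation (fun y x => beta x y) omega tau B A.
Proof.
rewrite /correlation exchange_big; apply: eq_bigr => y _; apply: eq_bigr => x _.
exact: mulrAC.
Qed.

Lemma mxtrace_cond (B : 'M[C]_n) (x : X) :
  \tr (B *m cond x) = \sum_y (beta x y)%:C * \tr (B *m omega y).
Proof.
rewrite mulmx_sumr raddf_sum; apply: eq_bigr => y _ /=.
by rewrite -scalemxAr mxtraceZ.
Qed.

Lemma correlation_cond (A : 'M[C]_m) (B : 'M[C]_n) :
  corr A B = \sum_x \tr (A *m tau x) * \tr (B *m cond x).
Proof.
apply: eq_bigr => x _; rewrite mxtrace_cond mulr_sumr; apply: eq_bigr => y _.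
by rewrite mulrCA mulrA.
Qed.

Lemma correlation_marg (A : 'M[C]_m) (B : 'M[C]_n) : corr A B = \tr (B *m marg A).
Proof.
rewrite correlation_cond mulmx_sumr raddf_sum; apply: eq_bigr => x _ /=.
by rewrite -scalemxAr mxtraceZ.
Qed.

Lemma witness_cond : W = \sum_x tensmx (tau x)^T (cond x)^T.
Proof.
apply: eq_bigr => x _; rewrite [(cond x)^T]raddf_sum.
rewrite [RHS](_ : _ = \sum_y tensmx (tau x)^T ((beta x y)%:C *: omega y)^T).
  apply: eq_bigr => y _; apply/matrixP => i j; rewrite !mxE; exact: mulrCA.
apply/matrixP => i j; rewrite !mxE summxE summxE mulr_sumr.
by apply: eq_bigr => y _; rewrite !mxE.
Qed.

(** The transposes on [A] and [B] cancel those built into the witness. *)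
Lemma mxtrace_witness_tens (A : 'M[C]_m) (B : 'M[C]_n) :
  \tr (W *m tensmx A^T B^T) = corr A B.
Proof.
rewrite mulmx_suml raddf_sum; apply: eq_bigr => x _ /=.
rewrite mulmx_suml raddf_sum; apply: eq_bigr => y _ /=.
rewrite -scalemxAl mxtraceZ tensmx_mul mxtrace_tens -!trmx_mul !mxtrace_tr.
by rewrite mulrA.
Qed.

(** Unless [A] or [B] is zero, [A^T] tensor [B^T] is a product state up to a positive factor. *)
Lemma correlation_ge0 (A : 'M[C]_m) (B : 'M[C]_n) :
  weakly_optimal_witness W -> psdmx A -> psdmx B -> 0 <= corr A B.
Proof.
move=> [W_ge0 _ _] pA pB.
have [->|A0] := eqVneq A 0.
  by rewrite correlation_cond big1 // => x _; rewrite mul0mx mxtrace0 mul0r.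
have [->|B0] := eqVneq B 0.
  by rewrite correlation_cond big1 // => x _; rewrite mul0mx mxtrace0 mulr0.
have trN0 (k : nat) (M : 'M[C]_k) : psdmx M -> M != 0 -> 0 < \tr M.
  move=> pM M0; rewrite lt_def mxtrace_psd_ge0 // andbT.
  by apply: contra_neq M0; apply: mxtrace_psd_eq0.
pose a := (\tr A^T)^-1; pose b := (\tr B^T)^-1.
have a0 : 0 < a by rewrite invr_gt0 mxtrace_tr trN0.
have b0 : 0 < b by rewrite invr_gt0 mxtrace_tr trN0.
have sep : is_separable_state (tensmx (a *: A^T) (b *: B^T)).
  exists 1%N, (fun=> 1), (fun=> a *: A^T), (fun=> b *: B^T).
  rewrite !big_ord1 scale1r; split=> // _.
  by split; apply: is_state_normalize; rewrite ?trmx_eq0 //; apply: psdmx_trmx.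
have := W_ge0 _ sep.
rewrite -!linearZ /= mxtrace_witness_tens.
suff -> : corr (a *: A) (b *: B) = a * b * corr A B.
  by rewrite pmulr_rge0 // mulr_gt0.
rewrite !correlation_cond mulr_sumr; apply: eq_bigr => x _.
by rewrite -!scalemxAl !mxtraceZ mulrACA.
Qed.

(** An operator in this cone has nonnegative trace against every state, including the detected
    entangled one. *)
Lemma witness_not_psd_tensor_sum :
  weakly_optimal_witness W -> ~ psd_tensor_sum W.
Proof.
move=> [_ _ [rho [[prho _] _] Wrho]] [I [P [Q [pP pQ WE]]]].
have rho_ge0 k : 0 <= \tr (tensmx (P k) (Q k) *m rho).
  by apply: mxtrace_psd_mul_ge0 => //; apply: psdmx_tens.
have /le_gtF : 0 <= \tr (W *m rho).
  by rewrite WE mulmx_suml raddf_sum; apply: sumr_ge0 => k _; apply: rho_ge0.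
by rewrite Wrho.
Qed.

End Correlation.

Lemma psd_tensor_sum_swap (R : realType) (m n : nat) (X Y : finType)
    (beta : X -> Y -> R) (tau : X -> 'M[R[i]]_m) (omega : Y -> 'M[R[i]]_n) :
  psd_tensor_sum (witness_operator (fun y x => beta x y) omega tau) ->
  psd_tensor_sum (witness_operator beta tau omega).
Proof.
move=> [I [P [Q [pP pQ WE]]]]; exists I, Q, P; split=> //.
(* Reindexing the product basis this way exchanges the tensor factors. *)
pose swap (k : 'I_(m * n)) : 'I_(n * m) :=
  mxtens_index ((mxtens_unindex k).2, (mxtens_unindex k).1).
have swap_tens (A : 'M[R[i]]_n) (B : 'M[R[i]]_m) :
    mxsub swap swap (tensmx A B) = tensmx B A.
  by apply/matrixP => k l; rewrite !mxE !mxtens_indexK mulrC.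
transitivity (mxsub swap swap
    (witness_operator (fun y x => beta x y) omega tau)).
  rewrite raddf_sum /witness_operator exchange_big; apply: eq_bigr => y _ /=.
  rewrite raddf_sum; apply: eq_bigr => x _ /=.
  by rewrite linearZ /= swap_tens.
by rewrite WE raddf_sum; apply: eq_bigr => k _; apply: swap_tens.
Qed.

(** * Constraints on a witness, and the vanishing case *)

Section Witness.
Variables (R : realType) (m n : nat) (X Y : finType) (beta : X -> Y -> R).
Variables (tau : X -> 'M[R[i]]_m) (omega : Y -> 'M[R[i]]_n).
Hypothesis tau_pure : forall x, is_pure_state (tau x).
Hypothesis omega_pure : forall y, is_pure_state (omega y).
Local Notation C := R[i].
Local Notation corr := (correlation beta tau omega).
Local Notation W := (witness_operator beta tau omega).
Local Notation cond := (conditional_operator beta omega).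
Local Notation marg := (marginal_operator beta tau omega).
(** This and the next hypothesis survive exchange of the parties, so the section serves either
    side. *)
Hypothesis corr_ge0 : forall A B, psdmx A -> psdmx B -> 0 <= corr A B.
Hypothesis W_not_psd : ~ psd_tensor_sum W.

Lemma cond_herm (x : X) : cond x \is hermsymmx.
Proof.
apply: hermsymmx_sum => y; apply: hermsymmxZ; last by case: (omega_pure y).
by rewrite realE -[0]/(0%:C) !lecR; apply: le_total.
Qed.

Lemma mxtrace_tau_ge0 (A : 'M[C]_m) (x : X) : psdmx A -> 0 <= \tr (A *m tau x).
Proof.
by move=> pA; apply: mxtrace_psd_mul_ge0 => //; case: (pure_is_state (tau_pure x)).
Qed.

Lemma marg_herm (A : 'M[C]_m) : psdmx A -> marg A \is hermsymmx.
Proof.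
move=> pA; apply: hermsymmx_sum => x; apply: hermsymmxZ; last exact: cond_herm.
exact/ger0_real/mxtrace_tau_ge0.
Qed.

Lemma marg_psd (A : 'M[C]_m) :
  psdmx A -> psdmx (marg A).
Proof.
move=> pA; apply: psdmx_of_mxtrace_ge0; first exact: marg_herm.
by move=> B pB; rewrite -correlation_marg; apply: corr_ge0.
Qed.

Lemma cond_not_psd : exists x, ~ psdmx (cond x).
Proof.
apply: contrapT => /forallNP cond_psd; apply: W_not_psd.
exists X, (fun x => (tau x)^T), (fun x => (cond x)^T); split.
- by move=> x; apply: psdmx_trmx; case: (pure_is_state (tau_pure x)).
- by move=> x; apply: psdmx_trmx; have /contrapT := cond_psd x.
exact: witness_cond.
Qed.

(** In dimension at most one every [tau x] is the identity, and the witness collapses to one product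
    of positive operators. Larger dimension makes pure states singular, as [singular_povm]
    requires. *)
Lemma witness_dim_gt1 (x0 : X) : (1 < m)%N.
Proof.
rewrite ltnNge; apply/negP => m_le1.
have tau1 x : tau x = 1%:M.
  have [_ PP rP] := tau_pure x.
  have Pu : tau x \in unitmx.
    by rewrite -row_free_unit /row_free eqn_leq rank_leq_row rP.
  by rewrite -[LHS](mulKmx Pu) PP mulVmx.
apply: W_not_psd.
exists unit, (fun=> 1%:M), (fun=> (marg 1%:M)^T); split.
- by move=> _; rewrite -(tau1 x0); case: (pure_is_state (tau_pure x0)).
- move=> _; apply/psdmx_trmx/marg_psd.
  by rewrite -(tau1 x0); case: (pure_is_state (tau_pure x0)).
rewrite witness_cond big_const card_unit /= addr0.
apply/matrixP => i j; rewrite summxE !mxE summxE mulr_sumr.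
apply: eq_bigr => x _; rewrite tau1 trmx1 mul1mx -(tau1 x) mxtrace_pure // tau1.
by rewrite scale1r !mxE.
Qed.

(* One party already gets zero: feeding it the noise A / Tr A at a single input
   isolates the operator of the other party at that input. *)
Lemma sensitive_of_vanishing (A : 'M[C]_m) :
  is_povm_operator A -> A != 0 ->
  (forall x, \tr (A *m tau x) = 0) -> sensitive beta tau omega.
Proof.
move=> pA A0 Atau t t0 t1.
have [x0 ncond] := cond_not_psd.
have [B pB trB] := povm_detects_not_psd (cond_herm x0) ncond.
have psdA : psdmx A by case: pA.
have rho_state := is_state_normalize psdA A0.
set rho := (\tr A)^-1 *: A in rho_state.
(* This is [\tr (A *m A)] over [\tr A]; as [A] is Hermitian, the numerator is its squared norm. *)
have trArho : 0 < \tr (A *m rho).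
  rewrite lt_def mxtrace_psd_mul_ge0 //; last by case: rho_state.
  rewrite andbT -scalemxAr mxtraceZ mulf_neq0 //.
    rewrite invr_eq0; apply: contra_neq A0; exact: mxtrace_psd_eq0.
  apply: contra_neq A0; case: psdA => /hermsymmxP {2}<- _.
  exact: mxtrace_adjmx_mul_eq0.
exists (mix_on tau t (pred1 x0) rho), omega; split.
- by apply: mix_onP => //; apply: ltW.
- move=> y; split; first exact: pure_is_state.
  have [_ PP _] := omega_pure y; rewrite PP mxtrace_pure //.
  have -> : (1 : C) = 1%:C by []; rewrite lecR.
  by rewrite lerBlDr lerDl ltW.
exists A, B; split=> //.
rewrite -[X in X < 0]/(correlation beta (mix_on tau t (pred1 x0) rho) omega A B).
rewrite (_ : correlation _ _ _ _ _ = t%:C * \tr (A *m rho) * \tr (B *m cond x0)).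
  by rewrite pmulr_rlt0 // mulr_gt0 // ltcR.
(* Inputs other than [x0] keep their [tau x], on which [A] gives zero. *)
rewrite correlation_cond (bigD1 x0) //= big1 ?addr0 => [|x /negbTE x_x0].
  by rewrite mxtrace_mix_on Atau mulr0 add0r /= eqxx mulr1.
by rewrite mxtrace_mix_on Atau mulr0 add0r /= x_x0 mulr0 !mul0r.
Qed.

End Witness.

(** * Exchange of parties and the case of singular operators *)

Lemma sensitive_swap (R : realType) (m n : nat) (X Y : finType)
    (beta : X -> Y -> R) (tau : X -> 'M[R[i]]_m) (omega : Y -> 'M[R[i]]_n) :
  sensitive (fun y x => beta x y) omega tau -> sensitive beta tau omega.
Proof.
move=> sens t t0 t1; have [omega' [tau' [homega htau]]] := sens t t0 t1.
move=> [B [A [pB pA corr_lt0]]]; exists tau', omega'; split=> //; exists A, B.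
split=> //; rewrite -/(correlation beta tau' omega' A B).
by rewrite correlation_swap.
Qed.

(** [A] and [B] give zero on the noise states, so mixing with weight [t] just multiplies the
    selected traces by [1 - t]. *)
Lemma sensitive_of_singular (R : realType) (m n : nat) (X Y : finType)
    (beta : X -> Y -> R) (tau : X -> 'M[R[i]]_m) (omega : Y -> 'M[R[i]]_n)
    (A : 'M[R[i]]_m) (B : 'M[R[i]]_n) (i : X) (j : Y) :
  (forall x, is_pure_state (tau x)) -> (forall y, is_pure_state (omega y)) ->
  is_povm_operator A -> is_povm_operator B ->
  A \notin unitmx -> B \notin unitmx ->
  correlation beta tau omega A B = 0 ->
  beta i j != 0 -> \tr (A *m tau i) != 0 -> \tr (B *m omega j) != 0 ->
  sensitive beta tau omega.
Proof.
move=> tau_pure omega_pure pA pB Au Bu corr0 bij Ai Bj t t0 t1.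
have [rho rho_state Arho] := singular_orthogonal_state Au.
have [sigma sigma_state Bsigma] := singular_orthogonal_state Bu.
(* The traces are nonnegative, hence real, and the shrinking argument can run over [R]. *)
pose a x := complex.Re (\tr (A *m tau x)).
pose b y := complex.Re (\tr (B *m omega y)).
have aE x : \tr (A *m tau x) = (a x)%:C.
  by rewrite RRe_real // ger0_real // mxtrace_tau_ge0 //; case: pA.
have bE y : \tr (B *m omega y) = (b y)%:C.
  by rewrite RRe_real // ger0_real // mxtrace_tau_ge0 //; case: pB.
have M0 : \sum_x \sum_y beta x y * a x * b y = 0.
  apply: (@complexI R); rewrite rmorph0 -[RHS]corr0 rmorph_sum.
  apply: eq_bigr => x _; rewrite rmorph_sum; apply: eq_bigr => y _ /=.
  by rewrite aE bE !rmorphM.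
have Mij : beta i j * a i * b j != 0.
  rewrite !mulf_neq0 //.
    by apply: contra_neq Ai => a0; rewrite aE a0.
  by apply: contra_neq Bj => b0; rewrite bE b0.
have [S [T ST_lt0]] := shrink_rows_cols_lt0 t0 M0 Mij.
exists (mix_on tau t S rho), (mix_on omega t T sigma); split.
- by apply: mix_onP => //; apply: ltW.
- by apply: mix_onP => //; apply: ltW.
exists A, B; split=> //; move: ST_lt0; rewrite -ltcR rmorph_sum.
congr (_ < _); apply: eq_bigr => x _; rewrite rmorph_sum.
apply: eq_bigr => y _ /=.
rewrite !mxtrace_mix_on Arho Bsigma !mulr0 !addr0 aE bE -!rmorphM.
congr (_%:C); rewrite -!mulrA; ring.
Qed.

(* In (i) the zero operators are excluded: for A = 0 or B = 0 the condition
   would hold vacuously for every witness. In (ii) this is automatic. *)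
Theorem proposition3 (R : realType) (m n : nat) (X Y : finType)
    (beta : X -> Y -> R) (tau : X -> 'M[R[i]]_m) (omega : Y -> 'M[R[i]]_n)
    (hW : is_MDIEW beta tau omega)
    (hAB : exists (A : 'M[R[i]]_m) (B : 'M[R[i]]_n),
      [/\ is_povm_operator A, is_povm_operator B &
        [/\ A != 0, B != 0 &
            forall x y, \tr (tensmx (tau x) (omega y) *m tensmx A B) = 0]
        \/
        (\sum_x \sum_y (beta x y)%:C
            * \tr (tensmx (tau x) (omega y) *m tensmx A B) = 0
         /\ exists (i : X) (j : Y),
              (beta i j)%:C
                * \tr (tensmx (tau i) (omega j) *m tensmx A B) != 0)]) :
  sensitive beta tau omega.
Proof.
have [[_ _] tau_pure omega_pure hopt] := hW.
set beta' := fun y x => beta x y.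
have corr_ge0 A B : psdmx A -> psdmx B -> 0 <= correlation beta tau omega A B.
  exact: correlation_ge0.
have corr_ge0' B A : psdmx B -> psdmx A -> 0 <= correlation beta' omega tau B A.
  by move=> pB pA; rewrite -correlation_swap; apply: corr_ge0.
have W_not_psd := witness_not_psd_tensor_sum hopt.
have W_not_psd' : ~ psd_tensor_sum (witness_operator beta' omega tau).
  by move=> /psd_tensor_sum_swap.
have trE x y A B : \tr (tensmx (tau x) (omega y) *m tensmx A B) =
    \tr (A *m tau x) * \tr (B *m omega y).
  by rewrite tensmx_mul mxtrace_tens ![\tr (_ *m tau x)]mxtrace_mulC
             ![\tr (_ *m omega y)]mxtrace_mulC.
have [A [B [pA pB]]] := hAB.
case=> [[A0 B0 tr0] | [sum0 [i [j]]]].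
  (* All products of traces vanish, so one nonzero trace for [A] forces every trace for [B] to be
     zero. *)
  have [x Ax|Atau] := pickP (fun x => \tr (A *m tau x) != 0); last first.
    apply: (sensitive_of_vanishing tau_pure omega_pure W_not_psd pA A0) => x.
    by have /negbFE/eqP := Atau x.
  apply: sensitive_swap.
  apply: (sensitive_of_vanishing omega_pure tau_pure W_not_psd' pB B0) => y.
  by have /eqP := tr0 x y; rewrite trE mulf_eq0 (negbTE Ax) => /eqP.
rewrite trE !mulf_eq0 !negb_or => /and3P[bij Ai Bj].
have bij0 : beta i j != 0 by apply: contra_neq bij => ->.
have corr0 : correlation beta tau omega A B = 0.
  rewrite -[RHS]sum0; apply: eq_bigr => x _; apply: eq_bigr => y _.
  by rewrite trE mulrA.
have [psdB _] := pB.
(* With [B] fixed, [A] is replaced first; the positive operator is the marginal of [B] in the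
   exchanged problem. *)
have [|A' [pA' A'u A'0 A'i]] := singular_povm
    (witness_dim_gt1 tau_pure omega_pure corr_ge0 W_not_psd i) pA
    (marg_psd omega_pure tau_pure corr_ge0' psdB) _ (tau_pure i) Ai.
  by rewrite -correlation_marg -correlation_swap.
rewrite -correlation_marg -correlation_swap in A'0.
have [psdA' _] := pA'.
(* [B] is then replaced against the marginal of the new [A'], so the correlation remains zero. *)
have [|B' [pB' B'u B'0 B'j]] := singular_povm
    (witness_dim_gt1 omega_pure tau_pure corr_ge0' W_not_psd' j) pB
    (marg_psd tau_pure omega_pure corr_ge0 psdA') _ (omega_pure j) Bj.
  by rewrite -correlation_marg.
rewrite -correlation_marg in B'0.
exact: sensitive_of_singular pA' pB' A'u B'u B'0 bij0 A'i B'j.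
Qed.
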